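(* Let $\mathcal{C}$ be a homological category, and let $(\mathbf{R},\mu)$ be an idempotent radical on it. Let $\mathcal{X}$ be the full reflective subcategory of objects $X$ of $\mathcal{C}$ with $\mathbf{R}(X)=0$, and $\mathbf{H}:\mathcal{X}\to\mathcal{C}$ the inclusion. The class $(\mathbf{H}(Mono\;\mathcal{X}))^{\uparrow\downarrow}$ is precisely the class of monomorphisms $C\rightarrowtail C'$ of $\mathcal{C}$ such that $\mathbf{R}(C')\subseteq C$ (as subobjects of $C'$).
   Context: A category is homological if it is pointed, regular and protomodular. A normal monomorphism is a monomorphism that is a kernel; in a homological category every normal monomorphism $C\rightarrowtail C'$ has a cokernel, whose codomain is denoted $C'/C$. A radical on a homological category $\mathcal{C}$ is a pair $(\mathbf{R},\mu)$, where $\mathbf{R}$ is an endofunctor of $\mathcal{C}$ and $\mu:\mathbf{R}\to 1_{\mathcal{C}}$ is a natural transformation such that, for every object $C$, $\mu_C:\mathbf{R}(C)\to C$ is a normal monomorphism and $\mathbf{R}(C/\mathbf{R}(C))=0$. The radical is idempotent if the morphism $\mathbf{R}(\mu_C)\,(=\mu_{\mathbf{R}(C)})$ is an isomorphism for every object $C$. The full subcategory $\mathcal{X}$ of objects $X$ with $\mathbf{R}(X)=0$ is reflective in $\mathcal{C}$, with reflector $C\mapsto C/\mathbf{R}(C)$ and unit the cokernel of $\mu_C$. $Mono\;\mathcal{X}$ denotes the class of monomorphisms of $\mathcal{X}$. For morphisms $e:A\to B$ and $m:C\to D$, write $e\downarrow m$ if for all $\alpha:A\to C$, $\beta:B\to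 D$ with $\beta e=m\alpha$ there is a unique $\delta:B\to C$ with $m\delta=\beta$ and $\delta e=\alpha$. For a class $\mathbb{N}$ of morphisms of $\mathcal{C}$, $\mathbb{N}^{\uparrow}$ is the class of all $f$ with $f\downarrow n$ for all $n\in\mathbb{N}$, and $\mathbb{N}^{\downarrow}$ is the class of all $f$ with $n\downarrow f$ for all $n\in\mathbb{N}$; $\mathbb{N}^{\uparrow\downarrow}=(\mathbb{N}^{\uparrow})^{\downarrow}$. For a monomorphism $m:C\rightarrowtail C'$, $\mathbf{R}(C')\subseteq C$ means that $\mu_{C'}$ factors through $m$. *)

(* Defs.v *)
(* Vanilla Rocq: equality of morphisms is Leibniz equality, and limits
   and colimits are universal properties rather than chosen operations. *)
From Corelib Require Import ssreflect ssrbool.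

Set Implicit Arguments.
Unset Strict Implicit.
Unset Printing Implicit Defensive.

Declare Scope cat_scope.
Delimit Scope cat_scope with cat.
Local Open Scope cat_scope.

Reserved Notation "a ~> b" (at level 90, right associativity).
Reserved Notation "g \o f" (at level 50, left associativity).

Record category : Type := Category {
  obj :> Type;
  hom : obj -> obj -> Type;
  idm : forall a, hom a a;
  comp : forall a b c, hom b c -> hom a b -> hom a c;
  comp_idl : forall a b (f : hom a b), comp (idm b) f = f;
  comp_idr : forall a b (f : hom a b), comp f (idm a) = f;
  comp_assoc : forall a b c d (h : hom c d) (g : hom b c) (f : hom a b),
    comp h (comp g f) = comp (comp h g) f }.

Arguments hom {c0} _ _ : rename.
Arguments idm {c0} _ : rename.
Arguments comp {c0 a b c} _ _ : rename.

Notation "a ~> b" := (hom a b) : cat_scope.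
Notation "g \o f" := (comp g f) : cat_scope.

Record functor (C D : category) : Type := Functor {
  fobj :> C -> D;
  fmap : forall a b : C, (a ~> b) -> (fobj a ~> fobj b);
  fmap_id : forall a : C, fmap (idm a) = idm (fobj a);
  fmap_comp : forall (a b c : C) (g : b ~> c) (f : a ~> b),
    fmap (g \o f) = fmap g \o fmap f }.

Arguments fmap {C D} f0 {a b} _ : rename.

Definition id_functor (C : category) : functor C C :=
  @Functor C C (fun a => a) (fun _ _ f => f)
    (fun _ => eq_refl) (fun _ _ _ _ _ => eq_refl).

Record nat_trans (C D : category) (F G : functor C D) : Type := NatTrans {
  component :> forall a : C, F a ~> G a;
  naturality : forall (a b : C) (f : a ~> b),
    component b \o fmap F f = fmap G f \o component a }.

Definition full_subcategory (C : category) (P : C -> Prop) : category :=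
  @Category {x : C | P x}
    (fun x y => proj1_sig x ~> proj1_sig y)
    (fun x => idm (proj1_sig x))
    (fun _ _ _ g f => g \o f)
    (fun _ _ f => comp_idl f)
    (fun _ _ f => comp_idr f)
    (fun _ _ _ _ h g f => comp_assoc h g f).

Definition inclusion (C : category) (P : C -> Prop) :
    functor (full_subcategory P) C :=
  @Functor (full_subcategory P) C (fun x => proj1_sig x) (fun _ _ f => f)
    (fun _ => eq_refl) (fun _ _ _ _ _ => eq_refl).

Section Morphisms.
Variable C : category.
Implicit Types a b c : C.

Definition is_mono a b (f : a ~> b) : Prop :=
  forall t (u v : t ~> a), f \o u = f \o v -> u = v.

Definition is_iso a b (f : a ~> b) : Prop :=
  exists g : b ~> a, g \o f = idm a /\ f \o g = idm b.

Definition is_terminal z : Prop :=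
  forall a, exists f : a ~> z, forall g : a ~> z, g = f.

Definition is_initial z : Prop :=
  forall a, exists f : z ~> a, forall g : z ~> a, g = f.

Definition is_zero z : Prop := is_initial z /\ is_terminal z.

Definition is_zero_mor a b (f : a ~> b) : Prop :=
  exists (z : C) (u : a ~> z) (v : z ~> b), is_zero z /\ f = v \o u.

(* The square f \o p = g \o q is a pullback. *)
Definition is_pullback a b c (f : a ~> c) (g : b ~> c)
    (x : C) (p : x ~> a) (q : x ~> b) : Prop :=
  f \o p = g \o q /\
  forall (t : C) (u : t ~> a) (v : t ~> b), f \o u = g \o v ->
    exists! w : t ~> x, p \o w = u /\ q \o w = v.

Definition is_coequalizer a b (f g : a ~> b) c (q : b ~> c) : Prop :=
  q \o f = q \o g /\
  forall t (u : b ~> t), u \o f = u \o g -> exists! w : c ~> t, w \o q = u.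

Definition is_kernel a b (f : a ~> b) k (i : k ~> a) : Prop :=
  is_zero_mor (f \o i) /\
  forall t (u : t ~> a), is_zero_mor (f \o u) -> exists! w : t ~> k, i \o w = u.

Definition is_cokernel a b (f : a ~> b) c (q : b ~> c) : Prop :=
  is_zero_mor (q \o f) /\
  forall t (u : b ~> t), is_zero_mor (u \o f) -> exists! w : c ~> t, w \o q = u.

Definition is_normal_mono a b (m : a ~> b) : Prop :=
  is_mono m /\ exists (c : C) (f : b ~> c), is_kernel f m.

Definition is_regular_epi b c (q : b ~> c) : Prop :=
  exists (a : C) (f g : a ~> b), is_coequalizer f g q.

End Morphisms.

Section Homological.
Variable C : category.

Definition pointed : Prop := exists z : C, is_zero z.

Definition has_pullbacks : Prop :=
  forall (a b c : C) (f : a ~> c) (g : b ~> c),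
    exists (x : C) (p : x ~> a) (q : x ~> b), is_pullback f g p q.

Definition finitely_complete : Prop :=
  (exists z : C, is_terminal z) /\ has_pullbacks.

Definition regular : Prop :=
  [/\ finitely_complete,
      (* kernel pairs have coequalizers *)
      (forall (a b x : C) (f : a ~> b) (p q : x ~> a), is_pullback f f p q ->
         exists (c : C) (e : a ~> c), is_coequalizer p q e)
    & (* regular epimorphisms are pullback stable *)
      (forall (a b c x : C) (f : a ~> c) (g : b ~> c) (p : x ~> a) (q : x ~> b),
         is_pullback f g p q -> is_regular_epi f -> is_regular_epi q)].

(* The objects and morphisms of the category Pt_b(C) of points over b. *)
Record point (b : C) : Type := Point {
  pt_dom : C;
  pt_proj : pt_dom ~> b;
  pt_sec : b ~> pt_dom;
  pt_split : pt_proj \o pt_sec = idm b }.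

Record point_mor (b : C) (X Y : point b) : Type := PointMor {
  pt_mor :> pt_dom X ~> pt_dom Y;
  pt_mor_proj : pt_proj Y \o pt_mor = pt_proj X;
  pt_mor_sec : pt_mor \o pt_sec X = pt_sec Y }.

(* Every change-of-base functor v^* : Pt_b(C) -> Pt_e(C) reflects isomorphisms.
   Here p and q underlie v^*X and v^*Y, for an arbitrary choice of pullbacks, and
   g underlies v^*h (compatibility with the induced sections is automatic). A
   morphism of points is invertible iff its underlying morphism is. *)
Definition protomodular : Prop :=
  has_pullbacks /\
  forall (e b : C) (v : e ~> b) (X Y : point b) (h : point_mor X Y)
         (x y : C) (p : x ~> e) (p' : x ~> pt_dom X)
         (q : y ~> e) (q' : y ~> pt_dom Y) (g : x ~> y),
    is_pullback v (pt_proj X) p p' -> is_pullback v (pt_proj Y) q q' ->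
    q \o g = p -> q' \o g = h \o p' ->
    is_iso g -> is_iso h.

Definition homological : Prop := [/\ pointed, regular & protomodular].

End Homological.

(* The last field says R(a / R(a)) = 0. The quotient is determined up to
   isomorphism as a cokernel of mu_a; it exists when C is homological, since
   mu_a is then a normal monomorphism with a cokernel. *)
Record radical (C : category) : Type := Radical {
  rad :> functor C C;
  rad_mu : nat_trans rad (id_functor C);
  rad_normal : forall a : C, is_normal_mono (rad_mu a);
  rad_quotient : forall (a c : C) (q : a ~> c),
    is_cokernel (rad_mu a) q -> is_zero (rad c) }.

Definition idempotent (C : category) (R : radical C) : Prop :=
  forall a : C, is_iso (fmap R (rad_mu R a)).

Definition torsion_free (C : category) (R : radical C) : C -> Prop :=
  fun a => is_zero (R a).

Definition mor_class (C : category) : Type :=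
  forall a b : C, (a ~> b) -> Prop.

Inductive image_class (C D : category) (F : functor C D) (N : mor_class C) :
    mor_class D :=
  ImageClass : forall (a b : C) (f : a ~> b), N a b f -> image_class F N (fmap F f).

Section Orthogonality.
Variable C : category.

Definition orthogonal (a b c d : C) (e : a ~> b) (m : c ~> d) : Prop :=
  forall (alpha : a ~> c) (beta : b ~> d), beta \o e = m \o alpha ->
    exists! delta : b ~> c, m \o delta = beta /\ delta \o e = alpha.

Definition up_class (N : mor_class C) : mor_class C :=
  fun a b f => forall (c d : C) (n : c ~> d), N c d n -> orthogonal f n.

Definition down_class (N : mor_class C) : mor_class C :=
  fun a b f => forall (c d : C) (n : c ~> d), N c d n -> orthogonal n f.

End Orthogonality.

(* Main.v *)
From Corelib Require Import ssreflect ssrbool.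
Require Import Defs.
Local Open Scope cat_scope.

Set Implicit Arguments.
Unset Strict Implicit.
Unset Printing Implicit Defensive.

(** A subobject [A] of [B] containing [R B] is a pullback of a monomorphism of
    torsion-free objects.  Let [q : B -> Q] be the cokernel of [mu_B] and let
    [A -> I -> Q] be the image factorisation of the restriction of [q] to [A].
    Then [I] is torsion-free, being a subobject of [Q], and [A] and
    [P = q^-1(I)] are objects over [I] with the same kernel [R B]; pulling back
    along the regular epimorphism [A -> I] turns [A -> P] into a morphism of
    points, which is invertible by protomodularity, whence [A = P].

    Conversely, regular epimorphisms are orthogonal to the monomorphisms between
    torsion-free objects, and so is [0 -> R B] because [R (R B) = R B] admits
    only zero morphisms to torsion-free objects.  Orthogonality of [m] to the
    former makes it a monomorphism, orthogonality to the latter puts [R B]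
    inside it. *)

Section Category.
Variable C : category.
Implicit Types a b c d : C.

(** * Regular epimorphisms, monomorphisms and pullbacks *)

Lemma is_iso_id a : is_iso (idm a).
Proof. by exists (idm a); rewrite comp_idl. Qed.

Lemma mono_split_epi_iso a b (m : a ~> b) (s : b ~> a) :
  is_mono m -> m \o s = idm b -> is_iso m.
Proof.
move=> mono_m ms; exists s; split=> //; apply: mono_m.
by rewrite comp_assoc ms comp_idl comp_idr.
Qed.

Lemma coequalizer_epi a b (f g : a ~> b) c (q : b ~> c) d (u v : c ~> d) :
  is_coequalizer f g q -> u \o q = v \o q -> u = v.
Proof.
move=> [qfg univ] uqv.
have [|w [_ uniq]] := univ _ (v \o q); first by rewrite -!comp_assoc qfg.
by rewrite -(uniq _ uqv) -(uniq v).
Qed.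

Lemma regular_epi_epi b c (q : b ~> c) d (u v : c ~> d) :
  is_regular_epi q -> u \o q = v \o q -> u = v.
Proof. by move=> [a [f [g coeq_q]]]; apply: coequalizer_epi coeq_q. Qed.

Lemma pullback_hom_ext {a b c} {f : a ~> c} {g : b ~> c} {x} {p : x ~> a}
    {q : x ~> b} (pb : is_pullback f g p q) t (u v : t ~> x) :
  p \o u = p \o v -> q \o u = q \o v -> u = v.
Proof.
move: pb => [fpgq univ] puv quv.
have [|w [_ uniq]] := univ t (p \o v) (q \o v).
  by rewrite !comp_assoc fpgq.
by rewrite -(uniq u) // -(uniq v).
Qed.

Lemma regular_epi_orthogonal_mono a b c d (e : a ~> b) (m : c ~> d) :
  is_regular_epi e -> is_mono m -> orthogonal e m.
Proof.
move=> [t [f [g coeq_e]]] mono_m u v veqmu.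
have [efg univ] := coeq_e.
have [|w [we uniq]] := univ _ u.
  apply: mono_m; rewrite !comp_assoc -veqmu -!comp_assoc efg //.
exists w; split=> [|w' [_ w'e]]; last exact: uniq.
by split=> //; apply: coequalizer_epi coeq_e _; rewrite -comp_assoc we.
Qed.

(** * Zero morphisms and zero objects *)

Lemma zero_mor_unique a b (f g : a ~> b) :
  is_zero_mor f -> is_zero_mor g -> f = g.
Proof.
move=> [z [u [v [[ini ter] ->]]]] [z' [u' [v' [[ini' ter'] ->]]]].
have [w _] := ini z'; have [x xP] := ter' a; have [y yP] := ini b.
by rewrite (xP u') -(xP (w \o u)) comp_assoc (yP v) (yP (v' \o w)).
Qed.

Lemma zero_mor_compl a b c (g : b ~> c) (f : a ~> b) :
  is_zero_mor f -> is_zero_mor (g \o f).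
Proof.
by move=> [z [u [v [z0 ->]]]]; exists z, u, (g \o v); rewrite comp_assoc.
Qed.

Lemma zero_mor_compr a b c (g : b ~> c) (f : a ~> b) :
  is_zero_mor g -> is_zero_mor (g \o f).
Proof.
by move=> [z [u [v [z0 ->]]]]; exists z, (u \o f), v; rewrite comp_assoc.
Qed.

Lemma zero_mor_to a z (f : a ~> z) : is_zero z -> is_zero_mor f.
Proof. by exists z, f, (idm z); rewrite comp_idl. Qed.

Lemma zero_mor_from z a (f : z ~> a) : is_zero z -> is_zero_mor f.
Proof. by exists z, (idm z), f; rewrite comp_idr. Qed.

Lemma zero_mor_exists a b : pointed C -> exists f : a ~> b, is_zero_mor f.
Proof.
move=> [z z0]; have [_ ter] := z0; have [ini _] := z0.
have [u _] := ter a; have [v _] := ini b.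
by exists (v \o u), z, u, v.
Qed.

Lemma mono_zero_mor a b c (m : b ~> c) (f : a ~> b) :
  pointed C -> is_mono m -> is_zero_mor (m \o f) -> is_zero_mor f.
Proof.
move=> pt mono_m mf0; have [o o0] := zero_mor_exists a b pt.
by rewrite (mono_m _ f o) //; apply: zero_mor_unique => //; apply: zero_mor_compl.
Qed.

Lemma zero_idm_zero a : is_zero_mor (idm a) -> is_zero a.
Proof.
move=> [z [u [v [[ini ter] idE]]]]; split=> b.
- have [f fP] := ini b; exists (f \o u) => g.
  by rewrite -(comp_idr g) idE comp_assoc (fP (g \o v)).
- have [f fP] := ter b; exists (v \o f) => g.
  by rewrite -(comp_idl g) idE -comp_assoc (fP (u \o g)).
Qed.

(** * Kernels and their behaviour under pullback *)

Lemma kernel_mono a b (f : a ~> b) k (i : k ~> a) : is_kernel f i -> is_mono i.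
Proof.
move=> [fi0 univ] t u v iuv.
have [|w [_ uniq]] := univ t (i \o v).
  by rewrite comp_assoc; apply: zero_mor_compr.
by rewrite -(uniq u) // -(uniq v).
Qed.

(** Presents a kernel as a change of base, the form in which [protomodular] can be applied. *)
Lemma kernel_pullback_zero a b (f : a ~> b) k (i : k ~> a) z
    (v : z ~> b) (p : k ~> z) :
  is_kernel f i -> is_zero z -> is_pullback v f p i.
Proof.
move=> [fi0 univ] z0; split.
  by apply: zero_mor_unique => //; apply: zero_mor_compr; apply: zero_mor_from.
move=> t u w vufw.
have [|x [ix uniq]] := univ t w.
  by rewrite -vufw; apply: zero_mor_compr; apply: zero_mor_from.
exists x; split=> [|y [_ iy]]; last exact: uniq.
by split=> //; apply: zero_mor_unique; apply: zero_mor_to.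
Qed.

(** A morphism killed by [p] is determined by its composite with [q], which [g] kills. *)
Lemma pullback_kernel a b c (f : a ~> c) (g : b ~> c) x (p : x ~> a) (q : x ~> b)
    k (i : k ~> b) (j : k ~> x) :
  is_pullback f g p q -> is_kernel g i -> is_zero_mor (p \o j) -> q \o j = i ->
  is_kernel p j.
Proof.
move=> pb ker_i pj0 qj; split=> // t u pu0.
have [fpgq _] := pb; have [_ univ] := ker_i.
have [|w [iw _]] := univ t (q \o u).
  by rewrite comp_assoc -fpgq -comp_assoc; apply: zero_mor_compl.
exists w; split=> [|w' ju].
  apply: (pullback_hom_ext pb); last by rewrite comp_assoc qj.
  by apply: zero_mor_unique => //; rewrite comp_assoc; apply: zero_mor_compr.
by apply: (kernel_mono ker_i); rewrite iw -qj -comp_assoc ju.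
Qed.

Lemma pullback_kernel_exists a b c (f : a ~> c) (g : b ~> c) x (p : x ~> a)
    (q : x ~> b) k (i : k ~> b) :
  pointed C -> is_pullback f g p q -> is_kernel g i ->
  exists j : k ~> x, q \o j = i /\ is_kernel p j.
Proof.
move=> pt pb ker_i; have [o o0] := zero_mor_exists k a pt.
have [_ univ] := pb; have [gi0 _] := ker_i.
have [|j [[pj qj] _]] := univ k o i.
  by apply: zero_mor_unique => //; apply: zero_mor_compl.
by exists j; split=> //; apply: (pullback_kernel pb ker_i) => //; rewrite pj.
Qed.

(** * Equalizers and image factorisation *)

Lemma equalizer_exists a b (f g : a ~> b) :
  finitely_complete C ->
  exists (x : C) (e : x ~> a), [/\ is_mono e, f \o e = g \o e &
    forall t (u : t ~> a), f \o u = g \o u -> exists w, e \o w = u].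
Proof.
move=> [[z ter] pbs]; have [bang bangP] := ter b.
(* The product of [b] with itself is a pullback over a terminal object; the equalizer is the
   pullback of [(f, g)] along its diagonal. *)
have [prod [p1 [p2 pb]]] := pbs _ _ _ bang bang.
have [_ univ] := pb.
have toz t (u v : t ~> b) : bang \o u = bang \o v.
  by have [o oP] := ter t; rewrite (oP (bang \o u)) (oP (bang \o v)).
have [fg [[fg1 fg2] _]] := univ _ f g (toz _ _ _).
have [diag [[diag1 diag2] _]] := univ _ (idm b) (idm b) (toz _ _ _).
have [x [e [h eq_pb]]] := pbs _ _ _ fg diag.
have [fgeh eq_univ] := eq_pb.
have feh : f \o e = h.
  by rewrite -fg1 -comp_assoc fgeh comp_assoc diag1 comp_idl.
have geh : g \o e = h.
  by rewrite -fg2 -comp_assoc fgeh comp_assoc diag2 comp_idl.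
exists x, e; split=> [t u v euv||t u fugu].
- by apply: (pullback_hom_ext eq_pb) => //; rewrite -feh -!comp_assoc euv.
- by rewrite feh geh.
- have [|w [[ew _] _]] := eq_univ t u (f \o u); last by exists w.
  apply: (pullback_hom_ext pb); rewrite !comp_assoc.
  + by rewrite fg1 diag1 comp_idl.
  + by rewrite fg2 diag2 comp_idl fugu.
Qed.

Lemma regular_image_factorization a b (f : a ~> b) :
  regular C ->
  exists (i : C) (e : a ~> i) (n : i ~> b),
    [/\ is_regular_epi e, is_mono n & n \o e = f].
Proof.
move=> [[_ pbs] coeqs stable].
have [x [p1 [p2 pb]]] := pbs _ _ _ f f.
have [i [e coeq_e]] := coeqs _ _ _ _ _ _ pb.
have [fp12 x_univ] := pb; have [ep12 e_univ] := coeq_e.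
have [n [ne _]] := e_univ _ _ fp12.
have reg_e : is_regular_epi e by exists x, p1, p2.
exists i, e, n; split=> // t u v nuv.
(* After composition with the regular epimorphisms [s1] and [s2], both [u] and [v] lift along [e].
   The lifts form a morphism into the kernel pair of [f], whose projections [e] identifies. *)
have [t1 [a1 [s1 pb1]]] := pbs _ _ _ e u.
have reg1 := stable _ _ _ _ _ _ _ _ pb1 reg_e.
have [t2 [a2 [s2 pb2]]] := pbs _ _ _ e (v \o s1).
have reg2 := stable _ _ _ _ _ _ _ _ pb2 reg_e.
have [e1 _] := pb1; have [e2 _] := pb2.
have [|w [[p1w p2w] _]] := x_univ _ (a1 \o s2) a2.
  rewrite -ne -(comp_assoc n e a2) e2 !comp_assoc -nuv.
  by rewrite -(comp_assoc n e a1) e1 !comp_assoc.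
apply: (regular_epi_epi reg1); apply: (regular_epi_epi reg2).
by rewrite -e1 -e2 -comp_assoc -p1w -p2w !comp_assoc ep12.
Qed.

(** * Consequences of protomodularity *)

(** The kernel of the projection of a point is its change of base along a
    morphism from the zero object. *)
Lemma point_mor_kernel_iso b (X Y : point b) (h : point_mor X Y)
    k (i : k ~> pt_dom X) :
  pointed C -> protomodular C ->
  is_kernel (pt_proj X) i -> is_kernel (pt_proj Y) (h \o i) -> is_iso h.
Proof.
move=> [z z0] [_ proto] kerX kerY.
have [v _] := proj1 z0 b; have [p _] := proj2 z0 k.
apply: (proto _ _ v X Y h _ _ p i p (h \o i) (idm k)).
- exact: kernel_pullback_zero.
- exact: kernel_pullback_zero.
- by rewrite comp_idr.
- by rewrite comp_idr.
- exact: is_iso_id.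
Qed.

(** The diagonal of the kernel pair of [f] and the kernel of its first
    projection are jointly epimorphic, by protomodularity. *)
Lemma kernel_coequalizes_kernel_pair a b (f : a ~> b) k (i : k ~> a) x
    (p1 p2 : x ~> a) c (u : a ~> c) :
  homological C -> is_kernel f i -> is_pullback f f p1 p2 ->
  is_zero_mor (u \o i) -> u \o p1 = u \o p2.
Proof.
move=> [pt [fc _ _] proto] ker_i pb ui0.
have [_ univ] := pb.
have [diag [[p1d p2d] _]] := univ _ (idm a) (idm a) eq_refl.
have [j [p2j ker_j]] := pullback_kernel_exists pt pb ker_i.
(* Both the diagonal and the kernel of [p1] factor through this equalizer [e]. As a morphism of
   points over [a] it is therefore invertible, so the two composites agree. *)
have [w [e [mono_e ue e_univ]]] := equalizer_exists (u \o p1) (u \o p2) fc.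
have [|s es] := e_univ _ diag.
  by rewrite -!comp_assoc p1d p2d.
have [p1j0 _] := ker_j.
have [|j' ej'] := e_univ _ j.
  apply: zero_mor_unique; rewrite -comp_assoc; last by rewrite p2j.
  exact: zero_mor_compl.
have p1es : (p1 \o e) \o s = idm a by rewrite -comp_assoc es.
pose X := Point p1es; pose Y := Point p1d.
pose h := @PointMor _ _ X Y e eq_refl es.
have [||e' [_ ee']] := @point_mor_kernel_iso _ X Y h _ j' pt proto.
- split=> /= [|t v p1ev0]; first by rewrite -comp_assoc ej'.
  have [|y [jy uniq]] := proj2 ker_j t (e \o v); first by rewrite comp_assoc.
  exists y; split=> [|y' j'y']; first by apply: mono_e; rewrite comp_assoc ej'.
  by apply: uniq; rewrite -j'y' comp_assoc ej'.
- by rewrite /= ej'.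
- rewrite -(comp_idr (u \o p1)) -(comp_idr (u \o p2)) -ee' /=.
  by rewrite !comp_assoc ue.
Qed.

(** The cokernel is the coequalizer of the kernel pair of any [f] with kernel [k]; since [f] factors
    through it, [k] is its kernel. *)
Lemma normal_mono_cokernel a b (k : a ~> b) :
  homological C -> is_normal_mono k ->
  exists (c : C) (q : b ~> c),
    [/\ is_regular_epi q, is_cokernel k q & is_kernel q k].
Proof.
move=> HC [mono_k [d [f ker_k]]].
have [_ [[_ pbs] coeqs _] _] := HC.
have [x [p1 [p2 pb]]] := pbs _ _ _ f f.
have [c [q coeq_q]] := coeqs _ _ _ _ _ _ pb.
have [qp12 q_univ] := coeq_q; have [fp12 _] := pb.
have [f' [f'q _]] := q_univ _ _ fp12.
have [pt _ _] := HC.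
have qk0 : is_zero_mor (q \o k).
  have [j [p2j [p1j0 _]]] := pullback_kernel_exists pt pb ker_k.
  by rewrite -p2j comp_assoc -qp12 -comp_assoc; apply: zero_mor_compl.
exists c, q; split; first by exists x, p1, p2.
- split=> // t u uk0; apply: q_univ.
  exact: kernel_coequalizes_kernel_pair HC ker_k pb uk0.
- split=> // t u qu0; apply: (proj2 ker_k).
  by rewrite -f'q -comp_assoc; apply: zero_mor_compl.
Qed.

(** Pulling [j] back along the regular epimorphism [e] gives a morphism of
    points, split by the diagonal, which is an isomorphism on kernels. *)
Lemma mono_over_same_kernel_iso a p i k (e : a ~> i) (r : p ~> i) (j : a ~> p)
    (l : k ~> a) :
  homological C -> is_regular_epi e -> is_mono j -> r \o j = e ->
  is_kernel e l -> is_kernel r (j \o l) -> is_iso j.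
Proof.
move=> [pt [[_ pbs] _ stable] proto] reg_e mono_j rj ker_e ker_r.
have [x [x1 [x2 pbx]]] := pbs _ _ _ e e.
have [y [y1 [y2 pby]]] := pbs _ _ _ e r.
have [ex12 x_univ] := pbx; have [_ y_univ] := pby.
have [dx [[x1d x2d] _]] := x_univ _ (idm a) (idm a) eq_refl.
have [|h [[y1h y2h] _]] := y_univ _ x1 (j \o x2); first by rewrite comp_assoc rj.
have hd : y1 \o (h \o dx) = idm a by rewrite comp_assoc y1h.
pose X := Point x1d; pose Y := Point hd.
pose hXY := @PointMor _ _ X Y h y1h eq_refl.
have [o [x2o ker_x1]] := pullback_kernel_exists pt pbx ker_e.
have [||h' [_ hh']] := @point_mor_kernel_iso _ X Y hXY _ o pt proto => //=.
  apply: (pullback_kernel pby ker_r).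
    by rewrite comp_assoc y1h; case: ker_x1.
  by rewrite comp_assoc y2h -comp_assoc x2o.
have reg_y2 := stable _ _ _ _ _ _ _ _ pby reg_e.
(* As [y2] is a regular epimorphism and [j] a monomorphism, this square has a diagonal, which is a
   section of [j]. *)
have y2E : idm p \o y2 = j \o (x2 \o h').
  by rewrite comp_idl comp_assoc -y2h -comp_assoc hh' comp_idr.
have [s [[js _] _]] := regular_epi_orthogonal_mono reg_y2 mono_j y2E.
exact: mono_split_epi_iso mono_j js.
Qed.

End Category.

(** * Torsion-free objects *)

Section Radical.
Variables (C : category) (R : radical C).
Hypothesis HC : homological C.
Local Notation mu := (rad_mu R).

Lemma rad_naturality a b (f : a ~> b) : mu b \o fmap R f = f \o mu a.
Proof. exact: (naturality mu f). Qed.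

Lemma rad_mono a : is_mono (mu a).
Proof. by case: (rad_normal R a). Qed.

Lemma torsion_free_mor_rad a b (f : a ~> b) :
  torsion_free R b -> is_zero_mor (f \o mu a).
Proof.
by move=> b0; rewrite -rad_naturality; apply: zero_mor_compr; apply: zero_mor_from.
Qed.

(** Here [mu a] is both zero and a monomorphism, so the identity of [R a] is zero. *)
Lemma torsion_free_sub a b (n : a ~> b) :
  is_mono n -> torsion_free R b -> torsion_free R a.
Proof.
have [pt _ _] := HC; move=> mono_n b0; apply: zero_idm_zero.
apply: (mono_zero_mor pt (@rad_mono a)); rewrite comp_idr.
exact: (mono_zero_mor pt mono_n (torsion_free_mor_rad n b0)).
Qed.

Lemma torsion_free_quotient b :
  exists (c : C) (q : b ~> c),
    [/\ torsion_free R c, is_regular_epi q, is_cokernel (mu b) q &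
        is_kernel q (mu b)].
Proof.
have [c [q [reg_q coker_q ker_q]]] := normal_mono_cokernel HC (rad_normal R b).
by exists c, q; split=> //; apply: rad_quotient coker_q.
Qed.

(** The inclusion of a reflective subcategory preserves monomorphisms. *)
Lemma mono_torsion_free (x y : full_subcategory (torsion_free R)) (n : x ~> y) :
  is_mono n -> @is_mono C (proj1_sig x) (proj1_sig y) n.
Proof.
move=> mono_n t u v nuv.
(* Morphisms from [t] to torsion-free objects factor uniquely through the reflection [c], so [n]
   need only be tested on [c]. *)
have [c [q [c0 _ [_ univ] _]]] := torsion_free_quotient t.
have [u' [u'q _]] := univ _ u (torsion_free_mor_rad u (proj2_sig x)).
have [v' [v'q _]] := univ _ v (torsion_free_mor_rad v (proj2_sig x)).
pose n' : proj1_sig x ~> proj1_sig y := n.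
have [w [_ uniq]] := univ _ _ (torsion_free_mor_rad (n' \o u) (proj2_sig y)).
rewrite -u'q -v'q; congr (_ \o _).
apply: (mono_n (exist _ c c0) u' v'); change (n' \o u' = n' \o v').
have <- : w = n' \o u' by apply: uniq; rewrite -comp_assoc u'q.
by apply: uniq; rewrite -comp_assoc v'q.
Qed.

(** * Orthogonality to monomorphisms of torsion-free objects *)

Definition torsion_free_monos : mor_class C :=
  image_class (inclusion (torsion_free R))
              (@is_mono (full_subcategory (torsion_free R))).

Lemma regular_epi_up a b (e : a ~> b) :
  is_regular_epi e -> up_class torsion_free_monos e.
Proof.
move=> reg_e c d _ [x y n mono_n].
by apply: regular_epi_orthogonal_mono => //; apply: mono_torsion_free.
Qed.

Hypothesis HR : idempotent R.

Lemma idempotent_mor_torsion_free a b (f : R a ~> b) :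
  torsion_free R b -> is_zero_mor f.
Proof.
move=> b0.
(* Naturality at [mu a], with [mu a] cancelled; idempotence then makes [mu (R a)] invertible. *)
have muE : fmap R (mu a) = mu (R a).
  by apply: (@rad_mono a); rewrite rad_naturality.
have [s [_ mus]] := HR a; rewrite muE in mus.
rewrite -(comp_idr f) -mus comp_assoc; apply: zero_mor_compr.
exact: torsion_free_mor_rad.
Qed.

(** By idempotence every morphism from [R b] to a torsion-free object is zero, so the zero morphism
    is the diagonal. *)
Lemma initial_rad_up b z (e : z ~> R b) :
  is_zero z -> up_class torsion_free_monos e.
Proof.
have [pt _ _] := HC.
move=> z0 c d _ [x y n /mono_torsion_free mono_n] u v _.
have v0 := idempotent_mor_torsion_free v (proj2_sig y).
have [o o0] := zero_mor_exists (R b) (proj1_sig x) pt.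
have no : fmap (inclusion (torsion_free R)) n \o o = v by apply: zero_mor_unique => //; apply: zero_mor_compl.
exists o; split=> [|o' [no' _]]; last by apply: mono_n; apply: eq_trans no _.
by split=> //; apply: zero_mor_unique; apply: zero_mor_from.
Qed.

(** * Morphisms in the double orthogonal class *)

Lemma down_up_mono a b (m : a ~> b) :
  down_class (up_class torsion_free_monos) m -> is_mono m.
Proof.
have [_ [[_ pbs] coeqs _] _] := HC.
move=> down_m.
have [x [p1 [p2 pb]]] := pbs _ _ _ m m.
have [i [e coeq_e]] := coeqs _ _ _ _ _ _ pb.
have [mp12 univ] := pb; have [ep12 e_univ] := coeq_e.
have [n [ne _]] := e_univ _ _ mp12.
have up_e : up_class torsion_free_monos e.
  by apply: regular_epi_up; exists x, p1, p2.
(* The diagonal [s] is a retraction of [e], which coequalizes the kernel pair of [m]; hence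
   [p1 = p2]. *)
have [|s [[_ se] _]] := down_m _ _ _ up_e (idm a) n; first by rewrite comp_idr.
move=> t u v muv.
have [w [[<- <-] _]] := univ _ _ _ muv.
by rewrite -(comp_idl p1) -(comp_idl p2) -se -(comp_assoc s e p1) ep12 comp_assoc.
Qed.

Lemma down_up_contains_rad a b (m : a ~> b) :
  down_class (up_class torsion_free_monos) m ->
  exists k : R b ~> a, m \o k = mu b.
Proof.
have [[z z0] _ _] := HC; move=> down_m.
have [e _] := proj1 z0 (R b); have [u _] := proj1 z0 a.
have [|k [[mk _] _]] := down_m _ _ e (initial_rad_up z0) u (mu b).
  by apply: zero_mor_unique; apply: zero_mor_from.
by exists k.
Qed.

(** * Subobjects containing the radical *)

Lemma contains_rad_pullback a b (m : a ~> b) (k : R b ~> a) :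
  is_mono m -> m \o k = mu b ->
  exists (i c : C) (n : i ~> c) (q : b ~> c) (e : a ~> i),
    [/\ torsion_free R i, torsion_free R c, is_mono n & is_pullback n q e m].
Proof.
have [pt reg _] := HC; have [[_ pbs] _ _] := reg.
move=> mono_m mk.
have [c [q [c0 _ _ ker_q]]] := torsion_free_quotient b.
have [i [e [n [reg_e mono_n ne]]]] := regular_image_factorization (q \o m) reg.
have [p [r [s pb]]] := pbs _ _ _ n q.
have [nrqs p_univ] := pb.
have [j [[rj sj] _]] := p_univ _ _ _ ne.
have mono_j : is_mono j.
  by move=> t u v juv; apply: mono_m; rewrite -sj -!comp_assoc juv.
have ek0 : is_zero_mor (e \o k).
  apply: (mono_zero_mor pt mono_n); rewrite comp_assoc ne -comp_assoc mk.
  by case: ker_q.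
have ker_r : is_kernel r (j \o k).
  apply: (pullback_kernel pb ker_q); first by rewrite comp_assoc rj.
  by rewrite comp_assoc sj.
(* The kernel property passes from [r] to [e] along the monomorphism [j]. *)
have ker_e : is_kernel e k.
  split=> // t u eu0.
  have [|w [jkw uniq]] := proj2 ker_r t (j \o u); first by rewrite comp_assoc rj.
  exists w; split=> [|w' kw']; first by apply: mono_j; rewrite comp_assoc.
  by apply: uniq; rewrite -comp_assoc kw'.
have [j' [j'j jj']] := mono_over_same_kernel_iso HC reg_e mono_j rj ker_e ker_r.
exists i, c, n, q, e; split=> //; first exact: torsion_free_sub mono_n c0.
split=> // t u v nuqv.
have [w [[rw sw] uniq]] := p_univ _ _ _ nuqv.
have mw : m \o (j' \o w) = v.
  by rewrite comp_assoc -sj -(comp_assoc s) jj' comp_idr.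
exists (j' \o w); split=> [|w' [_ mw']]; last by apply: mono_m; rewrite mw.
by split=> //; rewrite comp_assoc -rj -(comp_assoc r) jj' comp_idr.
Qed.

(** Right orthogonality is stable under pullback: a diagonal for [n] induces one for [m]. *)
Lemma contains_rad_down_up a b (m : a ~> b) (k : R b ~> a) :
  is_mono m -> m \o k = mu b -> down_class (up_class torsion_free_monos) m.
Proof.
move=> mono_m mk.
have [i [c [n [q [e [i0 c0 mono_n [neqm univ]]]]]]] :=
  contains_rad_pullback mono_m mk.
move=> x y f up_f u v vfmu.
have Nn : torsion_free_monos n.
  pose I : full_subcategory (torsion_free R) := exist _ i i0.
  pose J : full_subcategory (torsion_free R) := exist _ c c0.
  apply: (@ImageClass _ _ (inclusion (torsion_free R)) _ I J n) => t g h.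
  exact: mono_n.
have [|d [[nd _] _]] := up_f _ _ _ Nn (e \o u) (q \o v).
  by rewrite comp_assoc neqm -!comp_assoc vfmu.
have [w [[_ mw] _]] := univ _ _ _ nd.
exists w; split=> [|w' [mw' _]]; last by apply: mono_m; rewrite mw.
by split=> //; apply: mono_m; rewrite comp_assoc mw.
Qed.

End Radical.

Theorem proposition4p8 (C : category) (HC : homological C)
    (R : radical C) (HR : idempotent R) (A B : C) (m : A ~> B) :
  down_class (up_class
    (image_class (inclusion (torsion_free R))
                 (@is_mono (full_subcategory (torsion_free R))))) m
  <-> is_mono m /\ (exists k : R B ~> A, m \o k = rad_mu R B).
Proof.
split=> [down_m | [mono_m [k mk]]].
- by split; [apply: down_up_mono down_m | apply: down_up_contains_rad down_m].
- exact: contains_rad_down_up mono_m mk.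
Qed.
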